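(* Let $f$ and $g$ be consensus functions on the $n$-cube $Q_n$, and let $x_0$ be a vertex of $Q_n$. If $f$ and $g$ both satisfy the Translation axiom (T) and agree at $x_0$, then $f = g$.
   Context: $Q_n=(X,E)$ is the $n$-dimensional hypercube graph with vertex set $X=\{0,1\}^n$. A profile is a finite sequence $\pi=(x_1,\dots,x_k)$ of vertices of $X$ of any length $k\ge 1$; $X^*=\bigcup_{k\ge1}X^k$ is the set of all profiles. A consensus function on $Q_n$ is a map $f:X^*\to 2^X\setminus\{\emptyset\}$, i.e. it assigns to each profile a nonempty set of vertices. For $u,v\in X$, $u\oplus v$ denotes coordinatewise addition modulo 2, and for a profile $\pi=(x_1,\dots,x_k)$ and $v \in X$, $\pi\oplus v=(x_1\oplus v,\dots,x_k\oplus v)$. Translation (T): for every profile $\pi$ and all vertices $u,v\in X$, $u\in f(\pi)$ implies $u\oplus v\in f(\pi\oplus v)$. Two consensus functions $f,g$ agree at a vertex $x_0$ if for every profile $\pi$: $x_0\in f(\pi)$ if and only if $x_0\in g(\pi)$. *)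

(* Defs.v *)
From mathcomp Require Import all_boot.

Set Implicit Arguments.
Unset Strict Implicit.
Unset Printing Implicit Defensive.

(* Only the vertex set {0,1}^n of the n-cube is used: neither the translation
   axiom nor agreement at a vertex refers to edges. *)
Definition vertex (n : nat) := {ffun 'I_n -> bool}.

Definition vadd (n : nat) (u v : vertex n) : vertex n :=
  [ffun i => u i (+) v i].

Definition profile (n : nat) := {s : seq (vertex n) | 0 < size s}.

Lemma translate_subproof (n : nat) (p : profile n) (v : vertex n) :
  0 < size [seq vadd x v | x <- val p].
Proof. by rewrite size_map; exact: valP p. Qed.

Definition translate (n : nat) (p : profile n) (v : vertex n) : profile n :=
  exist _ [seq vadd x v | x <- val p] (translate_subproof p v).

Record consensus (n : nat) := Consensus {
  consensus_fun :> profile n -> {set vertex n};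
  consensus_neq0 : forall p : profile n, consensus_fun p != set0
}.

Definition translation_axiom (n : nat) (f : consensus n) : Prop :=
  forall (p : profile n) (u v : vertex n),
    u \in f p -> vadd u v \in f (translate p v).

Definition agree_at (n : nat) (f g : consensus n) (x0 : vertex n) : Prop :=
  forall p : profile n, x0 \in f p <-> x0 \in g p.

(* Main.v *)
Require Import Defs.
From mathcomp Require Import all_boot.
From Stdlib Require Import FunctionalExtensionality.

(** Translations act transitively on the vertices of the cube: adding
    [w = u + x0] carries [u] to [x0].  If [u] is in [f p], Translation puts [x0]
    in [f (p + w)], hence in [g (p + w)] by agreement at [x0]; adding [w] again
    undoes the translation, because every vertex is its own inverse, and puts
    [u] in [g p].  So [f p] is a subset of [g p] ([agree_at_subset]), and
    equality follows by exchanging [f] and [g]. *)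

Lemma vaddC {n : nat} (u w : vertex n) : vadd u w = vadd w u.
Proof. by apply/ffunP => i; rewrite !ffunE addbC. Qed.

Lemma vaddKr {n : nat} (u w : vertex n) : vadd (vadd u w) w = u.
Proof. by apply/ffunP => i; rewrite !ffunE addbK. Qed.

Lemma vaddKl {n : nat} (u w : vertex n) : vadd u (vadd u w) = w.
Proof. by apply/ffunP => i; rewrite !ffunE addKb. Qed.

Lemma translateK {n : nat} (p : profile n) (w : vertex n) :
  translate (translate p w) w = p.
Proof.
apply/val_inj; rewrite /= -map_comp -[RHS]map_id.
by apply: eq_map => x; exact: vaddKr.
Qed.

Lemma agree_at_sym {n : nat} {f g : consensus n} {x0 : vertex n} :
  agree_at f g x0 -> agree_at g f x0.
Proof. by move=> fg p; split=> /fg. Qed.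

(** Agreement at one vertex spreads to every vertex [u], by translating with
    [u + x0] to reach [x0] and then once more to come back. *)
Lemma agree_at_subset {n : nat} {f g : consensus n} {x0 : vertex n} :
  translation_axiom f -> translation_axiom g -> agree_at f g x0 ->
  forall p, f p \subset g p.
Proof.
move=> Tf Tg fg p; apply/subsetP => u fu; pose w := vadd u x0.
have /fg gx0 : x0 \in f (translate p w) by rewrite -(vaddKl u x0); exact: Tf.
by have := Tg _ _ w gx0; rewrite translateK /w vaddC vaddKr.
Qed.

(** The nonemptiness field is a family of boolean equations, so it carries no
    information beyond the underlying function. *)
Lemma consensus_ext {n : nat} (f g : consensus n) :
  (forall p, f p = g p) -> f = g.
Proof.
case: f g => [f f0] [g g0] /= /functional_extensionality fg.
case: g / fg g0 => g0; congr Consensus.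
by apply: functional_extensionality_dep => p; exact: bool_irrelevance.
Qed.

Theorem theorem1 (n : nat) (f g : consensus n) (x0 : vertex n)
  (hTf : translation_axiom f) (hTg : translation_axiom g)
  (hfg : agree_at f g x0) : f = g.
Proof.
apply: consensus_ext => p; apply/eqP; rewrite eqEsubset.
rewrite (agree_at_subset hTf hTg hfg).
exact: agree_at_subset hTg hTf (agree_at_sym hfg) p.
Qed.
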